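(* Let $R$ be a Bezout ring and $\mathcal{A}\subseteq \mathrm{Spec}(R)$. Then $\mathcal{A}$ has the P.A-property if and only if $\mathcal{A}$ is compact.
   Context: All rings are commutative with $1\neq 0$. A Bezout ring is a ring in which every finitely generated ideal is principal (zero divisors are allowed). A set $\mathcal{A}\subseteq \mathrm{Spec}(R)$ has the P.A-property (prime avoidance property) if whenever an ideal $I$ of $R$ satisfies $I\subseteq\bigcup_{P\in\mathcal{A}}P$, there exists $P\in\mathcal{A}$ with $I\subseteq P$. $\mathcal{A}$ carries the subspace topology of the Zariski topology on $\mathrm{Spec}(R)$; compact means every open cover has a finite subcover (no Hausdorff condition). *)

(* Defs.v *)
From HB Require Import structures.
From mathcomp Require Import all_boot all_order all_algebra.
From mathcomp Require Import ring_quotient.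
From mathcomp Require Import boolp classical_sets functions cardinality topology.

Set Implicit Arguments.
Unset Strict Implicit.
Unset Printing Implicit Defensive.

Import GRing.Theory.

Local Open Scope classical_set_scope.
Local Open Scope ring_scope.

Section Ideals.
Variable R : comNzRingType.
Implicit Types (I P S : set R).

(* The structures of ring_quotient only cover proper ideals, whereas the unit
   ideal has to be allowed here; idealP and prime_idealP below relate these
   predicates to the library's. *)
Definition ideal I : Prop :=
  [/\ I 0,
      forall x y, I x -> I y -> I (x + y)
    & forall a x, I x -> I (a * x)].

Definition prime_ideal P : Prop :=
  [/\ ideal P, ~ P 1 & forall x y, P (x * y) -> P x \/ P y].

Definition ideal_gen S : set R := smallest ideal S.

Definition finitely_generated I : Prop :=
  exists2 S : set R, finite_set S & I = ideal_gen S.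

Definition principal I : Prop := exists x : R, I = ideal_gen [set x].

Lemma ideal_gen_ideal S : ideal (ideal_gen S).
Proof.
split=> [J [[] //]|x y Ix Iy J JS|a x Ix J JS].
- by have [[_ JD _] _] := JS; apply: JD; [exact: Ix|exact: Iy].
- by have [[_ _ JM] _] := JS; apply: JM; exact: Ix.
Qed.

Lemma ideal_gen1 (x : R) : ideal_gen [set x] = [set a * x | a in [set: R]].
Proof.
apply/seteqP; split=> [y /(_ [set a * x | a in [set: R]])|_ [a _ <-] J [[_ _ JM] xJ]].
  apply; split; last by move=> _ ->; exists 1 => //; rewrite mul1r.
  split; first by exists 0 => //; rewrite mul0r.
  - by move=> _ _ [a _ <-] [b _ <-]; exists (a + b) => //; rewrite mulrDl.
  - by move=> a _ [b _ <-]; exists (a * b) => //; rewrite mulrA.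
by apply: JM; exact: xJ.
Qed.

Lemma idealP I : ideal I <-> submod_closed (mem I : {pred R^o}).
Proof.
split=> [[I0 ID IM]|[I0 IL]].
  split; first exact/mem_set.
  by move=> a u v /set_mem Iu /set_mem Iv; apply/mem_set/ID => //; exact: IM.
have I0' : I 0 := set_mem I0.
split=> // [x y Ix Iy|a x Ix].
  by have := IL 1 _ _ (mem_set Ix) (mem_set Iy); rewrite scale1r => /set_mem.
by have := IL a _ _ (mem_set Ix) (mem_set I0'); rewrite addr0 => /set_mem.
Qed.

Lemma prime_idealP P :
  prime_ideal P <-> idealr_closed (mem P) /\ prime_idealr_closed (mem P).
Proof.
split=> [[[P0 PD PM] P1 PP]|[[P0 P1 PL] PP]].
  split.
    split; [exact/mem_set|by apply/negP => /set_mem|].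
    by move=> a u v /set_mem Pu /set_mem Pv; apply/mem_set/PD => //; exact: PM.
  by move=> u v /set_mem/PP[Pu|Pv]; apply/orP; [left|right]; exact/mem_set.
have P0' : P 0 := set_mem P0.
split; [split=> // [x y Px Py|a x Px]| |].
- by have := PL 1 _ _ (mem_set Px) (mem_set Py); rewrite mul1r => /set_mem.
- by have := PL a _ _ (mem_set Px) (mem_set P0'); rewrite addr0 => /set_mem.
- by move=> /mem_set P1'; move/negP: P1; apply.
- by move=> x y /mem_set/PP/orP[] /set_mem; [left|right].
Qed.

End Ideals.

Definition bezout_ring (R : comNzRingType) : Prop :=
  forall I : set R, finitely_generated I -> principal I.

Record spec (R : comNzRingType) := Spec {
  spec_set :> set R;
  spec_prime : prime_ideal spec_set
}.

HB.instance Definition _ (R : comNzRingType) := gen_eqMixin (spec R).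
HB.instance Definition _ (R : comNzRingType) := gen_choiceMixin (spec R).

Section Zariski.
Variable R : comNzRingType.

Definition zero_locus (E : set R) : set (spec R) :=
  [set P : spec R | E `<=` P].

Definition zariski_open (U : set (spec R)) : Prop :=
  exists E : set R, U = ~` zero_locus E.

Lemma zariski_openT : zariski_open setT.
Proof.
exists setT; apply/seteqP; split=> // P _ /(_ 1 I).
by have [_ + _] := spec_prime P.
Qed.

Lemma zariski_openI : setI_closed zariski_open.
Proof.
move=> _ _ [E ->] [F ->].
exists [set x | exists2 a, E a & exists2 b, F b & x = a * b].
apply/seteqP; split=> [P [/existsNP[a /not_implyP[Ea Pa]]
    /existsNP[b /not_implyP[Fb Pb]]] EFP|P EFP].
  have [_ _ PP] := spec_prime P.
  by have [|//|//] := PP a b; apply: EFP; exists a => //; exists b.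
have [[_ _ PM] _ _] := spec_prime P.
by split=> EP; apply: EFP => _ [a Ea [b Fb ->]];
  [rewrite mulrC|]; apply: PM; exact: EP.
Qed.

Lemma zariski_open_bigU (K : Type) (f : K -> set (spec R)) :
  (forall i, zariski_open (f i)) -> zariski_open (\bigcup_i f i).
Proof.
move=> /choice[E fE]; exists (\bigcup_i E i).
apply/seteqP; split=> [P [i _]|P].
  by rewrite fE => EiP EP; apply: EiP => x Eix; apply: EP; exists i.
move=> /existsNP[x /not_implyP[[i _ Eix] Px]].
by exists i => //; rewrite fE => /(_ _ Eix).
Qed.

End Zariski.

HB.instance Definition _ (R : comNzRingType) :=
  isOpenTopological.Build (spec R)
    (@zariski_openT R) (@zariski_openI R) (@zariski_open_bigU R).

Lemma spec_openE (R : comNzRingType) (U : set (spec R)) :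
  open U <-> zariski_open U.
Proof. by []. Qed.

Definition PA_property (R : comNzRingType) (A : set (spec R)) : Prop :=
  forall I : set R, ideal I ->
    I `<=` \bigcup_(P in A) (P : set R) ->
    exists2 P : spec R, A P & I `<=` P.

(* Main.v *)
Require Import Defs.
From mathcomp Require Import all_boot all_order all_algebra.
From mathcomp Require Import finmap.
From mathcomp Require Import boolp classical_sets functions cardinality topology.

(** Write D(x) for the set of primes that do not contain [x].  The prime
    avoidance property says, by contraposition, that an ideal contained in no
    member of [A] has a single element [x] lying in no member of [A], i.e. with
    [A] contained in D(x).  The sets D(x) trace a basis of open sets on [A], so
    this resembles the extraction of a one-element subcover.

    Prime avoidance gives compactness over every ring.  Given an open cover of
    [A], the elements [x] for which the part of D(x) in [A] is covered by
    finitely many members form an ideal ([finitely_covered_ideal]), because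
    D(0) is empty, D(x + y) lies in the union of D(x) and D(y), and D(a * x)
    lies in D(x).  As the cover is open, this ideal is contained in no member of
    [A], so some element of it has D(x) containing the whole of [A].

    Conversely, if an ideal [I] is contained in no member of [A], the D(t) with
    [t] in [I] cover [A]; compactness leaves finitely many [t], and over a Bezout
    ring these generate a principal ideal, whose generator is an element of [I]
    that avoids every member of [A]. *)

Set Implicit Arguments.
Unset Strict Implicit.
Unset Printing Implicit Defensive.

Import GRing.Theory.

Local Open Scope classical_set_scope.
Local Open Scope ring_scope.

Section PrimeAvoidance.
Variable R : comNzRingType.
Implicit Types (I J S : set R) (A : set (spec R)) (P : spec R).

Definition distinguished A (x : R) : set (set_type A) :=
  [set P | ~ spec_set (set_val P) x].
Arguments distinguished : clear implicits.

Lemma ideal_gen_sub S J : ideal J -> S `<=` J -> ideal_gen S `<=` J.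
Proof. by move=> iJ SJ x; apply. Qed.

Lemma sub_ideal_gen S : S `<=` ideal_gen S.
Proof. by move=> x Sx J [_]; apply. Qed.

Lemma spec_ideal P : ideal P.
Proof. by have [] := spec_prime P. Qed.

Lemma distinguished_open A x : open (distinguished A x).
Proof.
exists (~` zero_locus [set x]); first by exists [set x].
apply/seteqP; split=> P /= nPx Px; apply: nPx; last exact: Px.
by move=> _ ->.
Qed.

Lemma distinguished_basis A (U : set (set_type A)) (P : set_type A) :
  open U -> U P -> exists2 x, distinguished A x P & distinguished A x `<=` U.
Proof.
move=> [_ [E ->] <-] /existsNP[x /not_implyP[Ex nPx]].
by exists x => // Q nQx EQ; apply: nQx; exact: EQ.
Qed.

(** Contraposition turns a condition on a union of primes into the existence of
    one distinguished open set containing all of [A], which is a condition on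
    covers. *)
Lemma PA_propertyP A :
  PA_property A <->
  forall I, ideal I -> (forall P, A P -> ~ I `<=` P) ->
    exists2 x, I x & distinguished A x = setT.
Proof.
split=> [PA I iI nIA|avoid I iI IA].
  apply: contrapT => nx; suff [P AP] : exists2 P, A P & I `<=` P by exact: nIA.
  apply: PA => // x Ix; apply: contrapT => nPx; apply: nx.
  exists x => //; apply/seteqP; split=> // P _ Px; apply: nPx.
  by exists (set_val P) => //; exact: set_valP.
apply: contrapT => nP; have [P AP IP|x Ix Dx] := avoid I iI.
  by apply: nP; exists P.
have [P AP Px] := IA x Ix.
by have : distinguished A x (SigSub (mem_set AP)) by rewrite Dx.
Qed.

(** Applying prime avoidance to this ideal gives a finite subcover at once: there
    is no need to write an element of an ideal as a combination of finitely many
    generators. *)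
Lemma finitely_covered_ideal A (K : choiceType) (D : set K)
    (f : K -> set (set_type A)) :
  ideal [set x | finite_subset_cover D f (distinguished A x)].
Proof.
split=> [|x y [X XD Xx] [Y YD Yy]|a x [X XD Xx]].
- exists fset0 => // P; case.
  by have [] := spec_ideal (set_val P).
- exists (X `|` Y)%fset => [i|P nPxy].
    by rewrite in_fsetU => /orP[/XD|/YD].
  have [Px|nPx] := pselect (spec_set (set_val P) x); last first.
    by have [i Xi fiP] := Xx P nPx; exists i => //=; rewrite in_fsetU Xi.
  have nPy : distinguished A y P.
    move=> Py; apply: nPxy.
    by have [_ PD _] := spec_ideal (set_val P); exact: PD.
  by have [i Yi fiP] := Yy P nPy; exists i => //=; rewrite in_fsetU Yi orbT.
- exists X => // P nPax; apply: Xx => Px; apply: nPax.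
  by have [_ _ PM] := spec_ideal (set_val P); exact: PM.
Qed.

Lemma PA_property_compact A : PA_property A -> cover_compact [set: set_type A].
Proof.
move=> /PA_propertyP avoid K D f fo cov.
have [P AP|x /= + Dx] := avoid _ (finitely_covered_ideal D f).
  have [i Di fiP] := cov (SigSub (mem_set AP)) Logic.I.
  have [x nPx xfi] := distinguished_basis (fo i Di) fiP.
  move=> /(_ x) Px; apply: nPx; apply: Px.
  exists [fset i]%fset => [j|Q nQx].
    by rewrite inE => /eqP ->; exact: mem_set.
  by exists i; [rewrite /= inE|exact: xfi].
by rewrite Dx.
Qed.

Lemma compact_PA_property A :
  bezout_ring R -> cover_compact [set: set_type A] -> PA_property A.
Proof.
move=> bezR cA; apply/PA_propertyP => I iI nIA.
have [|P _|X XI Xcov] := cA R I (distinguished A).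
- by move=> x _; exact: distinguished_open.
- have /existsNP[x /not_implyP[Ix nPx]] := nIA _ (set_valP P).
  by exists x.
(* The Bezout property merges the finitely many D(t) of the subcover into one. *)
have [x Xx] : principal (ideal_gen [set` X]).
  by apply: bezR; exists [set` X] => //; exact: finite_fset.
exists x.
  have XsubI : ideal_gen [set` X] `<=` I.
    by apply: ideal_gen_sub => // t /XI/set_mem.
  by apply: XsubI; rewrite Xx; exact: sub_ideal_gen.
apply/seteqP; split=> // P _ Px; have [t Xt nPt] := Xcov P Logic.I.
have xP : ideal_gen [set x] `<=` spec_set (set_val P).
  by apply: ideal_gen_sub => [|_ ->//]; exact: spec_ideal.
by apply: nPt; apply: xP; rewrite -Xx; exact: sub_ideal_gen.
Qed.

End PrimeAvoidance.

Theorem corollary2p10 (R : comNzRingType) (hR : bezout_ring R)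
    (A : set (spec R)) :
  PA_property A <-> cover_compact [set: set_type A].
Proof. by split; [exact: PA_property_compact|exact: compact_PA_property]. Qed.
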